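(* Let $P\in\mathbb{Z}[x_1,\ldots,x_n]$ and suppose that the equation $P(x_1,\ldots,x_n)=0$ is partition regular. Then: (1) $P$ satisfies the maximal Rado condition; (2) if $\tilde P$ is nonzero and splits over $\mathbb{Z}$ as a product of linear factors, then $P$ satisfies the minimal Rado condition.
   Context: Notation: $\mathbb{N}=\{1,2,3,\ldots\}$, $\mathbb{N}_0=\mathbb{N}\cup\{0\}$. For $P\in\mathbb{Z}[x_1,\ldots,x_n]$ write $P(x)=\sum_{\alpha\in\mathbb{N}_0^n}c_\alpha x^\alpha$ with $x^\alpha=x_1^{\alpha_1}\cdots x_n^{\alpha_n}$; $\mathrm{Supp}(P)=\{\alpha:c_\alpha\neq 0\}$; $|\alpha|=\alpha_1+\cdots+\alpha_n$; $\alpha!=\prod_i\alpha_i!$; $\frac{\partial^\alpha P}{\partial x^\alpha}=\frac{\partial^{|\alpha|}P}{\partial x_1^{\alpha_1}\cdots\partial x_n^{\alpha_n}}$. For $r\in\mathbb{Z}$, $\boldsymbol r=(r,\ldots,r)$ and $P^{(r)}(x)=P(x_1+r,\ldots,x_n+r)$; the coefficient of $x^\alpha$ in $P^{(r)}$ equals $\frac1{\alpha!}\frac{\partial^\alpha P}{\partial x^\alpha}(\boldsymbol r)$. $\tilde P(w)=P(w,\ldots,w)\in\mathbb{Z}[w]$. $\mathbb{Z}_p$ denotes the $p$-adic integers. Partition regularity: a finite coloring of a set $X$ is a map $c:X\to\{1,\ldots,k\}$; a set is $c$-monochromatic if $c$ is constant on it. A family $\mathcal A$ of subsets of $\mathbb{N}$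 is partition regular if for every finite coloring $c$ of $\mathbb{N}$ there are infinitely many $c$-monochromatic $A\in\mathcal A$. The equation $P=0$ is partition regular if the family $\{\{a_1,\ldots,a_n\}\subseteq\mathbb{N}:P(a_1,\ldots,a_n)=0\}$ is partition regular. Positive linear maps: a positive linear map is $\phi:\mathbb{Z}^n\to\mathbb{Z}$, $\phi(\alpha)=t_1\alpha_1+\cdots+t_n\alpha_n$ with $t_i\in\mathbb{N}_0$; it is $c$-monochromatic if $\{t_1,\ldots,t_n\}$ is $c$-monochromatic. If $M_0<\cdots<M_\ell$ is the increasing enumeration of $\phi(\mathrm{Supp}(P))$, the partition of $\mathrm{Supp}(P)$ determined by $\phi$ is the ordered tuple $(J_0,\ldots,J_\ell)$ with $J_i=\{\alpha\in\mathrm{Supp}(P):\phi(\alpha)=M_i\}$. Upper Rado functional of order $m\in\mathbb{N}_0$ for $P$: a tuple $(J_0,\ldots,J_\ell,d_0,\ldots,d_{m-1})$ with $\ell\ge m$, $d_i\in\mathbb{N}$, such that for every finite coloring $c$ of $\mathbb{N}$ and every $k\in\mathbb{N}$ there are infinitely many $c$-monochromatic positive linear maps $\phi$ such that $(J_\ell,\ldots,J_0)$ is the partition of $\mathrm{Supp}(P)$ determined by $\phi$ and, writing $M_\ell<\cdots<M_0$ for the increasing enumeration of $\phi(\mathrm{Supp}(P))$, $M_i-M_m=d_i$ for $0\le i\le m-1$ and $M_m-M_{m+1}\ge k$. Lower (also called minimal) Rado functional of order $m\in\mathbb{N}_0$ for $P$: a tuple $(J_0,\ldots,J_\ell,d_1,\ldots,d_m)$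 with $\ell\ge m$, $d_i\in\mathbb{N}$, such that for every finite coloring $c$ of $\mathbb{N}$ and every $k\in\mathbb{N}$ there are infinitely many $c$-monochromatic positive linear maps $\phi$ such that $(J_0,\ldots,J_\ell)$ is the partition of $\mathrm{Supp}(P)$ determined by $\phi$ and, writing $M_0<\cdots<M_\ell$ for the increasing enumeration of $\phi(\mathrm{Supp}(P))$, $M_i-M_0=d_i$ for $1\le i\le m$ and $M_{m+1}-M_m\ge k$. Maximal Rado condition: $P=\sum c_\alpha x^\alpha$ satisfies it if for every $q\in\mathbb{N}$, $q\ge 2$, there is an upper Rado functional $(J_0,\ldots,J_\ell,d_0,\ldots,d_{m-1})$ for $P$ such that, with $d_m:=0$, the polynomial $w\mapsto\sum_{i=0}^m q^{d_i}\sum_{\alpha\in J_i}c_\alpha w^{|\alpha|}$ has a (real) root in $[1,q]$. Minimal Rado condition (defined when $\tilde P$ is nonzero and splits as a product of linear factors over $\mathbb{Z}$): for every prime $p$ there are a root $a\in\mathbb{Z}$ of $\tilde P$ and a minimal (lower) Rado functional $(J_0,\ldots,J_\ell,d_1,\ldots,d_m)$ for $P^{(a)}$ such that, with $d_0:=0$, the equation $\sum_{i=0}^m p^{d_i}\sum_{\alpha\in J_i}\frac1{\alpha!}\frac{\partial^\alpha P}{\partial x^\alpha}(\boldsymbol a)w^{|\alpha|}=0$ has an invertible solution $w\in\mathbb{Z}_p$.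
   Formalization: In part (1) the polynomial P is assumed nonzero: for P = 0 the equation is partition regular, but Supp(P) is empty, so there is no upper Rado functional and the maximal Rado condition fails. *)

(* Defs.v *)
From HB Require Import structures.
From mathcomp Require Import all_boot all_order all_algebra finmap.
From mathcomp Require Import mpoly.
From mathcomp Require Import boolp classical_sets cardinality reals.

Set Implicit Arguments.
Unset Strict Implicit.
Unset Printing Implicit Defensive.

Import Order.TTheory GRing.Theory Num.Theory.

Local Open Scope ring_scope.

(** * The ring of p-adic integers

    The inverse limit of the rings Z/p^(k+1), k >= 0.  The exponent starts at 1
    because 'Z_1 is not the trivial ring; [padic p] is only meant to be used
    with p prime. *)

Definition padic_coherent (p : nat) (w : forall k, 'Z_(p ^ k.+1)) : Prop :=
  forall k, (w k.+1 : nat)%:R = w k.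

Record padic (p : nat) := Padic {
  padic_val :> forall k, 'Z_(p ^ k.+1);
  padic_valP : padic_coherent padic_val }.

HB.instance Definition _ p := gen_eqMixin (padic p).
HB.instance Definition _ p := gen_choiceMixin (padic p).

Section PadicRing.
Variable p : nat.
Implicit Types u v w : padic p.

Lemma padicP u v : (forall k, u k = v k) -> u = v.
Proof.
case: u v => [u hu] [v hv] /= uv; have euv : u = v by apply: functional_extensionality_dep.
by case: _ / euv hv => hv; congr Padic; apply: Prop_irrelevance.
Qed.

Definition padic_red k (x : 'Z_(p ^ k.+2)) : 'Z_(p ^ k.+1) := (x : nat)%:R.

Lemma padic_modulus k :
  ((Zp_trunc (p ^ k.+1)).+2 %| (Zp_trunc (p ^ k.+2)).+2)%N.
Proof.
case: p => [|[|q]]; first by rewrite !exp0n.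
  by rewrite !exp1n.
have gt1 j : (1 < q.+2 ^ j.+1)%N by rewrite -[1%N](expn0 q.+2) ltn_exp2l.
by rewrite !Zp_cast ?dvdn_exp2l.
Qed.

Lemma padic_red_nat k m : padic_red (m%:R : 'Z_(p ^ k.+2)) = m%:R.
Proof.
apply: val_inj; rewrite /padic_red !Zp_nat /=.
by rewrite modn_dvdm // padic_modulus.
Qed.

Lemma padic_redD k : {morph @padic_red k : x y / x + y}.
Proof.
by move=> x y; rewrite -[x]natr_Zp -[y]natr_Zp -natrD !padic_red_nat natrD.
Qed.

Lemma padic_redM k : {morph @padic_red k : x y / x * y}.
Proof.
by move=> x y; rewrite -[x]natr_Zp -[y]natr_Zp -natrM !padic_red_nat natrM.
Qed.

Lemma padic_redN k : {morph @padic_red k : x / - x}.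
Proof.
move=> x; apply/eqP; rewrite -addr_eq0 -padic_redD addNr.
exact/eqP/(padic_red_nat k 0).
Qed.

Fact padic0_proof : padic_coherent (fun k => 0 : 'Z_(p ^ k.+1)).
Proof. by move=> k; apply: (padic_red_nat k 0). Qed.
Definition padic0 := Padic padic0_proof.

Fact padic1_proof : padic_coherent (fun k => 1 : 'Z_(p ^ k.+1)).
Proof. by move=> k; apply: (padic_red_nat k 1). Qed.
Definition padic1 := Padic padic1_proof.

Fact padic_opp_proof u : padic_coherent (fun k => - u k).
Proof. by move=> k; rewrite -(padic_valP u k); apply: padic_redN. Qed.
Definition padic_opp u := Padic (padic_opp_proof u).

Fact padic_add_proof u v : padic_coherent (fun k => u k + v k).
Proof.
by move=> k; rewrite -(padic_valP u k) -(padic_valP v k); apply: padic_redD.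
Qed.
Definition padic_add u v := Padic (padic_add_proof u v).

Fact padic_mul_proof u v : padic_coherent (fun k => u k * v k).
Proof.
by move=> k; rewrite -(padic_valP u k) -(padic_valP v k); apply: padic_redM.
Qed.
Definition padic_mul u v := Padic (padic_mul_proof u v).

Fact padic_addA : associative padic_add.
Proof. by move=> u v w; apply: padicP => k; apply: addrA. Qed.
Fact padic_addC : commutative padic_add.
Proof. by move=> u v; apply: padicP => k; apply: addrC. Qed.
Fact padic_add0 : left_id padic0 padic_add.
Proof. by move=> u; apply: padicP => k; apply: add0r. Qed.
Fact padic_addN : left_inverse padic0 padic_opp padic_add.
Proof. by move=> u; apply: padicP => k; apply: addNr. Qed.

HB.instance Definition _ :=
  GRing.isZmodule.Build (padic p) padic_addA padic_addC padic_add0 padic_addN.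

Fact padic_mulA : associative padic_mul.
Proof. by move=> u v w; apply: padicP => k; apply: mulrA. Qed.
Fact padic_mulC : commutative padic_mul.
Proof. by move=> u v; apply: padicP => k; apply: mulrC. Qed.
Fact padic_mul1 : left_id padic1 padic_mul.
Proof. by move=> u; apply: padicP => k; apply: mul1r. Qed.
Fact padic_mulD : left_distributive padic_mul padic_add.
Proof. by move=> u v w; apply: padicP => k; apply: mulrDl. Qed.
Fact padic_1neq0 : padic1 != 0.
Proof. by apply/eqP => /(congr1 (fun u : padic p => u 0%N)). Qed.

HB.instance Definition _ :=
  GRing.Zmodule_isComNzRing.Build (padic p)
    padic_mulA padic_mulC padic_mul1 padic_mulD padic_1neq0.

Definition padic_unit : pred (padic p) := fun u => `[< exists v, v * u = 1 >].
Definition padic_inv u : padic p :=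
  if pselect (exists v, v * u = 1) is left h then projT1 (cid h) else u.

Fact padic_mulV : {in padic_unit, left_inverse 1 padic_inv *%R}.
Proof.
move=> u /asboolP h; rewrite /padic_inv; case: pselect => // h'.
by case: cid.
Qed.
Fact padic_unitP u v : v * u = 1 -> padic_unit u.
Proof. by move=> h; apply/asboolP; exists v. Qed.
Fact padic_inv_out : {in [predC padic_unit], padic_inv =1 id}.
Proof.
move=> u /asboolP h; rewrite /padic_inv; case: pselect => // h'.
Qed.

HB.instance Definition _ :=
  GRing.ComNzRing_hasMulInverse.Build (padic p)
    padic_mulV padic_unitP padic_inv_out.

End PadicRing.

Local Open Scope classical_set_scope.

(** * Partition regularity *)

(* A coloring of {1, 2, ...} is given by a function on nat whose value at 0 is
   irrelevant: a monochromatic set is a set of positive integers. *)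
Definition monochromatic (r : nat) (c : nat -> 'I_r) (A : set nat) : Prop :=
  (forall x, A x -> (0 < x)%N) /\ (forall x y, A x -> A y -> c x = c y).

Definition partition_regular (F : set (set nat)) : Prop :=
  forall (r : nat) (c : nat -> 'I_r),
    infinite_set [set A | F A /\ monochromatic c A].

Definition equation_partition_regular (n : nat) (P : {mpoly int[n]}) : Prop :=
  partition_regular
    [set A | exists a : 'I_n -> nat,
       [/\ forall i, (0 < a i)%N, P.@[fun i => (a i)%:Z] = 0 & A = range a]].

(** * Translates and diagonal of a polynomial *)

Definition mpoly_shift (n : nat) (a : int) (P : {mpoly int[n]}) : {mpoly int[n]} :=
  P \mPo [tuple 'X_i + a%:MP | i < n].

Definition mpoly_diag (n : nat) (P : {mpoly int[n]}) : {poly int} :=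
  mmap polyC (fun _ : 'I_n => 'X) P.

Definition splits_over_int (f : {poly int}) : Prop :=
  exists (c : int) (s : seq int), f = c *: \prod_(a <- s) ('X - a%:P).

(* The division is exact. *)
Definition taylor_coef (n : nat) (P : {mpoly int[n]}) (a : int)
    (alpha : 'X_{1..n}) : int :=
  ((P^`M[alpha]).@[fun=> a] %/ ((\prod_(i < n) (alpha i)`!)%N)%:Z)%Z.

(** * Positive linear maps

    The map alpha |-> t_1 alpha_1 + ... + t_n alpha_n is represented by its
    coefficients t. *)

Definition plm (n : nat) (t : {ffun 'I_n -> nat}) (alpha : 'X_{1..n}) : nat :=
  (\sum_(i < n) t i * alpha i)%N.

Definition plm_monochromatic (r : nat) (c : nat -> 'I_r) (n : nat)
    (t : {ffun 'I_n -> nat}) : Prop :=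
  monochromatic c (range t).

Definition plm_values (n : nat) (t : {ffun 'I_n -> nat}) (P : {mpoly int[n]}) :
    seq nat :=
  sort leq (undup [seq plm t alpha | alpha <- msupp P]).

Definition plm_partition (n : nat) (t : {ffun 'I_n -> nat})
    (P : {mpoly int[n]}) : seq {fset 'X_{1..n}} :=
  [seq [fset alpha in msupp P | plm t alpha == M]%fset | M <- plm_values t P].

(** * Rado functionals *)

(* M_(m+1) exists only if m < l; for m = l the gap condition is void. *)
Definition upper_rado_functional (n : nat) (P : {mpoly int[n]}) (l m : nat)
    (J : l.+1.-tuple {fset 'X_{1..n}}) (d : m.-tuple nat) : Prop :=
  [/\ (m <= l)%N, forall i : 'I_m, (0 < tnth d i)%N &
    forall (r : nat) (c : nat -> 'I_r) (k : nat), (0 < k)%N ->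
      infinite_set [set t : {ffun 'I_n -> nat} |
        let M := nth 0%N (rev (plm_values t P)) in
        [/\ plm_monochromatic c t,
            rev J = plm_partition t P,
            forall i : 'I_m, (M i - M m)%N = tnth d i &
            (m < l)%N -> (k <= M m - M m.+1)%N]]].

(* [tnth d i] is d_(i+1). *)
Definition lower_rado_functional (n : nat) (P : {mpoly int[n]}) (l m : nat)
    (J : l.+1.-tuple {fset 'X_{1..n}}) (d : m.-tuple nat) : Prop :=
  [/\ (m <= l)%N, forall i : 'I_m, (0 < tnth d i)%N &
    forall (r : nat) (c : nat -> 'I_r) (k : nat), (0 < k)%N ->
      infinite_set [set t : {ffun 'I_n -> nat} |
        let M := nth 0%N (plm_values t P) in
        [/\ plm_monochromatic c t,
            tval J = plm_partition t P,
            forall i : 'I_m, (M i.+1 - M 0)%N = tnth d i &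
            (m < l)%N -> (k <= M m.+1 - M m)%N]]].

(** * Rado conditions *)

(* The sum over i <= m of b^(e_i) * \sum_(alpha in J_i) C_alpha w^|alpha|. *)
Definition rado_poly (n : nat) (C : 'X_{1..n} -> int) (b m : nat)
    (J : seq {fset 'X_{1..n}}) (e : seq nat) : {poly int} :=
  \sum_(i < m.+1) (b ^ nth 0%N e i)%:R *:
    \sum_(alpha <- nth fset0 J i) C alpha *: 'X^(mdeg alpha).

Definition maximal_rado_condition (R : realType) (n : nat)
    (P : {mpoly int[n]}) : Prop :=
  forall q : nat, (2 <= q)%N ->
    exists (l m : nat) (J : l.+1.-tuple {fset 'X_{1..n}}) (d : m.-tuple nat),
      upper_rado_functional P J d /\
      exists w : R, 1 <= w <= q%:R /\
        root (map_poly intr (rado_poly (fun alpha => P@_alpha) q m J (rcons d 0%N))) w.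

Definition minimal_rado_condition (n : nat) (P : {mpoly int[n]}) : Prop :=
  forall p : nat, prime p ->
    exists (a : int) (l m : nat) (J : l.+1.-tuple {fset 'X_{1..n}})
      (d : m.-tuple nat),
      [/\ root (mpoly_diag P) a,
          lower_rado_functional (mpoly_shift a P) J d &
          exists w : padic p, w \is a GRing.unit /\
            root (map_poly intr (rado_poly (taylor_coef P a) p m J (0%N :: d))) w].

(* Main.v *)
From HB Require Import structures.
Require Import Defs.
From mathcomp Require Import all_boot all_order all_algebra finmap.
From mathcomp Require Import mpoly.
From mathcomp Require Import boolp classical_sets cardinality reals filter.
From mathcomp Require Import zify ring lra.

Set Implicit Arguments.
Unset Strict Implicit.
Unset Printing Implicit Defensive.

Import Order.TTheory GRing.Theory Num.Theory.

Local Open Scope ring_scope.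
Local Open Scope classical_set_scope.

(** Since every finite colouring of N admits arbitrarily large monochromatic
    solutions of P = 0, there is an ultrafilter U on N^n containing the set of
    solutions, the sets {x : x_i >= N for all i}, and all sets
    {x : f x_i = f x_j for all i, j} with f finite-valued.

    For (1), write x_i = q^(t_i) u_i with 1 <= u_i < q.  The u_i have a common
    limit w along U, and the t_i define monochromatic positive linear maps.
    Along U the induced partition of Supp(P) is constant, and each gap between
    consecutive values M_i is either constant or unbounded; let m be the index
    of the first unbounded gap.  Dividing
    0 = P(x) = \sum_i q^(M_i) \sum_(alpha in J_i) c_alpha u^alpha by q^(M_m) and
    passing to the limit gives the equation for w.

    For (2), P(x) = 0 and x_i = x_0 mod p^k force the diagonal of P to vanish at
    the common p-adic limit of the x_i, which is therefore an integer root a.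
    Then x_i = a + p^(t_i) y_i with y_i prime to p, and the same argument
    applies with the p-adic limit of the y_i, dividing by p^(M_0). *)

(** * Dichotomies along an ultrafilter *)

Section Ultrafilter.
Context {T : Type} {U : set_system T} {UU : UltraFilter U}.

Lemma ultra_dec (A : set T) : U A \/ U (~` A).
Proof. exact: in_ultra_setVsetC. Qed.

Lemma ultra_mem_seq (I : eqType) (f : T -> I) (s : seq I) :
  (\forall x \near U, f x \in s) -> exists y, \forall x \near U, f x = y.
Proof.
elim: s => [|y s IHs] Us; first by have [x] := filter_ex Us.
have [Uy|Uy] := ultra_dec [set x | f x = y]; first by exists y.
by apply: IHs; apply: filterS2 Us Uy => x; rewrite inE => /predU1P[].
Qed.

Lemma ultra_fin (I : finType) (f : T -> I) :
  exists y, \forall x \near U, f x = y.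
Proof.
apply: (@ultra_mem_seq _ _ (enum I)); apply: filterS filterT => x _.
exact: mem_enum.
Qed.

Lemma ultra_nat (f : T -> nat) :
  (exists d, \forall x \near U, f x = d) \/
  (forall k, \forall x \near U, (k <= f x)%N).
Proof.
have [[k Uk]|nUk] := pselect (exists k, \forall x \near U, (f x < k)%N).
  left; apply: (@ultra_mem_seq _ _ (iota 0 k)).
  by apply: filterS Uk => x; rewrite mem_iota.
right=> k; have [//|Uk] := ultra_dec [set x | (k <= f x)%N].
by case: nUk; exists k; apply: filterS Uk => x /= /negP; rewrite ltnNge.
Qed.

(** Here [g i] plays the role of the gap after the [i]-th value; [m] is the first index whose gap is
    unbounded along U, or [l] if all are constant. *)
Lemma ultra_gaps (g : nat -> T -> nat) (l : nat) :
  exists (m : nat) (e : nat -> nat), [/\ (m <= l)%N,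
    forall i, (i < m)%N -> \forall x \near U, g i x = e i &
    (m < l)%N -> forall k, \forall x \near U, (k <= g m x)%N].
Proof.
elim: l => [|l [m [e [le_ml Ue Um]]]].
  by exists 0%N, (fun=> 0%N); split.
have [lt_ml|le_lm] := ltnP m l.
  by exists m, e; split=> [||_]; [apply: leqW | | apply: Um].
have {le_lm le_ml Um} Em : m = l by apply/eqP; rewrite eqn_leq le_ml.
rewrite {m}Em in Ue *.
have [[d Ud]|Uinf] := ultra_nat (g l); last by exists l, e; split.
exists l.+1, (fun i => if i == l then d else e i); split=> [//|i|].
  by rewrite ltnS leq_eqVlt; case: eqP => [->|_] //= /Ue.
by rewrite ltnn.
Qed.

End Ultrafilter.

(** * Partition regularity and ultrafilters *)

Section Solutions.
Variables (n : nat) (P : {mpoly int[n]}).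
Hypothesis P_pr : equation_partition_regular P.

(** For n = 0 the only possible range is the empty set, and a family with at most one member is not
    infinite. *)
Lemma equation_pr_gt0 : (0 < n)%N.
Proof.
case: posnP => // n0; exfalso.
apply: (P_pr (c := fun=> ord0 : 'I_1)).
apply: (sub_finite_set _ (finite_set1 set0)) => A [[a [_ _ ->]] _] /=.
by apply/seteqP; split=> // x [[i lt_in]]; have := lt_in; rewrite {1}n0.
Qed.

(* Separating the integers below N from each other by their colours leaves
   only finitely many monochromatic sets that meet [0, N[. *)
Lemma equation_pr_large (I : finType) (c : nat -> I) (N : nat) :
  exists a : 'I_n -> nat, [/\ P.@[fun i => (a i)%:Z] = 0,
    forall i j, c (a i) = c (a j) & forall i, (N <= a i)%N].
Proof.
pose c' x : option 'I_N * I := (insub x, c x).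
apply: contrapT => nex; apply: (P_pr (c := fun x => enum_rank (c' x))).
apply: (@sub_finite_set _ _ [set [set x] | x in `I_N]); last first.
  exact/finite_image/finite_II.
move=> A [[a [a_gt0 Pa EA]] [_ cA]].
have cc i j : c' (a i) = c' (a j).
  by apply: enum_rank_inj; apply: cA; rewrite EA; [exists i | exists j].
have [i lt_aiN] : exists i, (a i < N)%N.
  apply: contrapT => nlt; apply: nex; exists a; split=> // [i j|i].
    by case: (cc i j).
  by rewrite leqNgt; apply/negP => lt_aN; apply: nlt; exists i.
(* Equal values of [insub] force every [a j] to be this [a i], so A is one of the singletons. *)
exists (a i) => //; rewrite EA; apply/seteqP; split=> x /= => [->|[j _ <-]].
  by exists i.
case: (cc j i); rewrite (insubT (fun x => x < N)%N lt_aiN).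
by case: insubP => // u _ <- [->].
Qed.

(** The sets [B] form a base of a proper filter: product colourings and maxima of bounds refine two
    of them, and [equation_pr_large] makes each one nonempty. Any ultrafilter above this filter will
    do. *)
Lemma equation_pr_ultra : exists2 U : set_system ('I_n -> nat), UltraFilter U &
  [/\ \forall a \near U, P.@[fun i => (a i)%:Z] = 0,
      forall N, \forall a \near U, forall i, (N <= a i)%N &
      forall (I : finType) (f : nat -> I),
        \forall a \near U, forall i j, f (a i) = f (a j)].
Proof.
pose B (d : {r : nat & nat -> 'I_r} * nat) := [set a : 'I_n -> nat |
  [/\ P.@[fun i => (a i)%:Z] = 0,
    forall i j, projT2 d.1 (a i) = projT2 d.1 (a j) &
    forall i, (d.2 <= a i)%N]].
(* [B] is indexed by colourings into ['I_r]; [D] recodes any finite palette, such as a product, by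
   [enum_rank]. *)
pose D (I : finType) (f : nat -> I) (N : nat) : {r : nat & nat -> 'I_r} * nat :=
  (existT _ _ (fun x => enum_rank (f x)), N).
have BF : ProperFilter (filter_from setT B).
  apply: filter_from_proper; last first.
    by move=> [[I f] N] _; apply: equation_pr_large.
  apply: filter_fromT_filter; first by exists (D unit (fun=> tt) 0%N).
  move=> [[r f] N] [[s g] M]; exists (D _ (fun x => (f x, g x)) (maxn N M)).
  move=> a [/= Pa /(_ _ _)/enum_rank_inj fg leNM].
  split; split=> //= [i j|i]; try by case: (fg i j).
    by apply: leq_trans (leNM i); apply: leq_maxl.
  by apply: leq_trans (leNM i); apply: leq_maxr.
have [U [UU BU]] := ultraFilterLemma BF; exists U => //; split.
- by apply: BU; exists (D unit (fun=> tt) 0%N) => // a [].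
- by move=> N; apply: BU; exists (D unit (fun=> tt) N) => // a [].
move=> I f; apply: BU; exists (D I f 0%N) => // a [_ fa _] i j.
exact/enum_rank_inj/fa.
Qed.

End Solutions.

(** * Positive linear maps and the support of a polynomial *)

Section PositiveLinearMaps.
Variables (n : nat) (P : {mpoly int[n]}) (t : {ffun 'I_n -> nat}).

Lemma plm_values_sorted : sorted ltn (plm_values t P).
Proof.
rewrite ltn_sorted_uniq_leq sort_uniq undup_uniq /=.
exact/sort_sorted/leq_total.
Qed.

Lemma plm_values_mem (alpha : 'X_{1..n}) :
  alpha \in msupp P -> plm t alpha \in plm_values t P.
Proof. by move=> Pa; rewrite mem_sort mem_undup map_f. Qed.

Lemma plm_values_gt0 : P != 0 -> (0 < size (plm_values t P))%N.
Proof.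
move/mlead_supp/plm_values_mem; case: (plm_values t P) => //.
Qed.

Lemma size_plm_partition : size (plm_partition t P) = size (plm_values t P).
Proof. exact: size_map. Qed.

Lemma size_plm_partition_le : (size (plm_partition t P) <= size (msupp P))%N.
Proof.
rewrite size_plm_partition size_sort (leq_trans (size_undup _)) //.
by rewrite size_map.
Qed.

Lemma plm_partition_sub (J : {fset 'X_{1..n}}) :
  J \in plm_partition t P ->
  J \in fpowerset [fset alpha in msupp P]%fset.
Proof.
case/mapP=> M _ ->; rewrite fpowersetE; apply/fsubsetP => alpha.
by rewrite !inE => /andP[].
Qed.

Lemma big_plm_partition (V : nmodType) (F : 'X_{1..n} -> V) :
  \sum_(alpha <- msupp P) F alpha =
  \sum_(i < size (plm_values t P))
    \sum_(alpha <- nth fset0 (plm_partition t P) i) F alpha.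
Proof.
transitivity (\sum_(M <- plm_values t P)
    \sum_(alpha <- msupp P | plm t alpha == M) F alpha).
  rewrite (exchange_big_dep xpredT) //= !big_seq; apply: eq_bigr => alpha Pa.
  rewrite -big_filter (eq_filter (a2 := pred1 (plm t alpha))); last first.
    by move=> M; apply: eq_sym.
  rewrite filter_pred1_uniq ?plm_values_mem ?big_seq1 //.
  by rewrite sort_uniq undup_uniq.
rewrite (big_nth 0%N) big_mkord; apply: eq_bigr => i _.
rewrite (nth_map 0%N) ?ltn_ord // -big_filter; apply: perm_big.
apply: uniq_perm; rewrite ?filter_uniq ?msupp_uniq ?fset_uniq // => alpha.
by rewrite mem_filter !inE andbC.
Qed.

(** If x_i = b^(t_i) u_i, then x^alpha = b^(phi(alpha)) u^alpha, where phi has coefficients t; the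
    terms are grouped by the value of phi. *)
Lemma mmap_plm (K : comNzRingType) (b : K) (u : 'I_n -> K) :
  mmap intr (fun i => b ^+ t i * u i) P =
  \sum_(i < size (plm_values t P)) b ^+ nth 0%N (plm_values t P) i *
    \sum_(alpha <- nth fset0 (plm_partition t P) i)
       (P@_alpha)%:~R * mmap1 u alpha.
Proof.
rewrite /mmap big_plm_partition; apply: eq_bigr => i _.
rewrite (nth_map 0%N) // mulr_sumr !big_seq; apply: eq_bigr => alpha.
rewrite !inE => /andP[_ /eqP <-]; rewrite mulrCA; congr (_ * _).
rewrite /mmap1 /plm expr_sum -big_split; apply: eq_bigr => j _.
by rewrite /= exprMn exprM.
Qed.

End PositiveLinearMaps.

Lemma mmap1_cst (n : nat) (K : comNzRingType) (w : K) (alpha : 'X_{1..n}) :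
  mmap1 (fun=> w) alpha = w ^+ mdeg alpha.
Proof. by rewrite /mmap1 mdegE prodrXr. Qed.

(** This is the shape of the sum in [mmap_plm] with all u_i equal to w, so the two can be compared
    term by term. *)
Lemma horner_rado_poly (n : nat) (C : 'X_{1..n} -> int) (b m : nat)
    (J : seq {fset 'X_{1..n}}) (e : seq nat) (K : comNzRingType) (w : K) :
  (map_poly intr (rado_poly C b m J e)).[w] =
  \sum_(i < m.+1) b%:R ^+ nth 0%N e i *
    \sum_(alpha <- nth fset0 J i) (C alpha)%:~R * mmap1 (fun=> w) alpha.
Proof.
rewrite rmorph_sum horner_sum; apply: eq_bigr => i _.
rewrite /= map_polyZ hornerZ /= rmorph_nat natrX; congr (_ * _).
rewrite rmorph_sum horner_sum; apply: eq_bigr => alpha _.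
by rewrite /= map_polyZ map_polyXn hornerZ hornerXn mmap1_cst.
Qed.

Lemma intr_meval (n : nat) (P : {mpoly int[n]}) (v : 'I_n -> int)
    (K : comNzRingType) :
  (P.@[v])%:~R = mmap intr (fun i => (v i)%:~R) P :> K.
Proof.
rewrite mevalE rmorph_sum; apply: eq_bigr => alpha _.
rewrite rmorphM rmorph_prod; congr (_ * _).
by apply: eq_bigr => i _; rewrite rmorphXn.
Qed.

(** * Positive linear maps along an ultrafilter *)

Section Ultrafilter.
Context {T : Type} {U : set_system T} {UU : UltraFilter U}.

(** There are finitely many sequences of bounded length over a finite alphabet; induction on the
    bound fixes the tail, then the head, with [None] for an empty sequence. *)
Lemma ultra_seq (I : eqType) (f : T -> seq I) (s : seq I) (N : nat) :
  (\forall x \near U, {subset f x <= s}) ->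
  (\forall x \near U, (size (f x) <= N)%N) ->
  exists y, \forall x \near U, f x = y.
Proof.
elim: N f => [|N IHN] f Us UN.
  by exists [::]; apply: filterS UN => x; rewrite leqn0 size_eq0 => /eqP.
have [||y Uy] := IHN (behead \o f).
- by apply: filterS Us => x sx z /mem_behead /sx.
- by apply: filterS UN => x; rewrite size_behead; case: (size _).
have [|z Uz] := @ultra_mem_seq _ _ _ _ (ohead \o f) (None :: map some s).
  apply: filterS Us => x /=; case: (f x) => // z s' sx.
  by rewrite inE /= map_f // sx ?mem_head.
exists (if z is Some z' then z' :: y else [::]).
by apply: filterS2 Uy Uz => x /= <- <-; case: (f x).
Qed.

End Ultrafilter.

Section UltrafilterOfMaps.
Variables (n : nat) (T : Type) (U : set_system T) (t : T -> {ffun 'I_n -> nat}).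
Context {UU : UltraFilter U}.

Section Functional.
Hypothesis n_gt0 : (0 < n)%N.
Hypothesis t_large : forall N, \forall x \near U, forall i, (N <= t x i)%N.

(** If A were finite, [t] would be constant along U, whereas its coordinates are unbounded; [n_gt0]
    provides a coordinate. *)
Lemma ultra_infinite (A : set {ffun 'I_n -> nat}) :
  (\forall x \near U, A (t x)) -> infinite_set A.
Proof.
move=> UA /finite_seqP[s As].
have [|y Uy] := @ultra_mem_seq _ _ _ _ t s.
  by apply: filterS UA => x; rewrite As.
have [x [<-]] := filter_ex (filterI Uy (t_large (y (Ordinal n_gt0)).+1)).
by move=> /(_ (Ordinal n_gt0)); rewrite ltnn.
Qed.

Hypothesis t_mono : forall (I : finType) (f : nat -> I),
  \forall x \near U, forall i j, f (t x i) = f (t x j).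

Lemma ultra_monochromatic (r : nat) (c : nat -> 'I_r) :
  \forall x \near U, plm_monochromatic c (t x).
Proof.
apply: filterS2 (t_mono c) (t_large 1) => x tc t1; split=> [_ [i _ <-]|].
  exact: t1.
by move=> _ _ [i _ <-] [j _ <-].
Qed.

End Functional.

Variable P : {mpoly int[n]}.
Hypothesis P_neq0 : P != 0.

Lemma ultra_partition : exists (l : nat) (J : l.+1.-tuple {fset 'X_{1..n}}),
  \forall x \near U, tval J = plm_partition (t x) P.
Proof.
have [||J UJ] := @ultra_seq _ _ _ _ (fun x => plm_partition (t x) P)
    (fpowerset [fset alpha in msupp P]%fset) (size (msupp P)).
- by apply: filterS filterT => x _ J; apply: plm_partition_sub.
- by apply: filterS filterT => x _; apply: size_plm_partition_le.
have szJ : size J == (size J).-1.+1.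
  have [x <-] := filter_ex UJ; rewrite size_plm_partition.
  by case: size (plm_values_gt0 (t x) P_neq0).
by exists (size J).-1, (Tuple szJ); apply: filterS UJ.
Qed.

(** The offsets in [d] are sums of the constant gaps that precede the first unbounded one. [J] and
    [d] are chosen before [k], since one functional has to serve every colouring and every [k]. *)
Lemma ultra_lower_gaps :
  exists (l m : nat) (J : l.+1.-tuple {fset 'X_{1..n}}) (d : m.-tuple nat),
    [/\ (m <= l)%N, forall i : 'I_m, (0 < tnth d i)%N &
    forall k, \forall x \near U,
      let M := nth 0%N (plm_values (t x) P) in
      [/\ tval J = plm_partition (t x) P,
          forall i : 'I_m, (M i.+1 - M 0 = tnth d i)%N &
          (m < l)%N -> (k <= M m.+1 - M m)%N]].
Proof.
have [l [J UJ]] := ultra_partition.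
pose M x := nth 0%N (plm_values (t x) P).
have [m [e [le_ml Ue Um]]] := ultra_gaps (fun i x => M x i.+1 - M x i)%N l.
have Md : \forall x \near U, forall i : 'I_m,
    (M x i.+1 - M x 0 = \sum_(0 <= j < i.+1) e j)%N /\ (0 < M x i.+1 - M x 0)%N.
  have {}Ue : \forall x \near U, forall i : 'I_m, (M x i.+1 - M x i = e i)%N.
    by apply: filter_forall => i; apply: Ue.
  apply: filterS2 UJ Ue => x Jx ex i.
  have szM : size (plm_values (t x) P) = l.+1.
    by rewrite -size_plm_partition -Jx size_tuple.
  have ltM j k : (j < k)%N -> (k <= m)%N -> (M x j < M x k)%N.
    move=> lt_jk le_km.
    by apply: (sorted_ltn_nth ltn_trans) (plm_values_sorted _ _) _ _ _ _ _;
      rewrite ?inE ?szM; lia.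
  have lt_im := ltn_ord i; rewrite subn_gt0 ltM //; split=> //.
  rewrite -telescope_sumn_in // => [|j /= hj]; last by apply/ltnW/ltM; lia.
  by apply: eq_big_nat => j hj; rewrite (ex (Ordinal (leq_trans hj lt_im))).
exists l, m, J, [tuple \sum_(0 <= j < i.+1) e j | i < m]%N; split=> // [i|k].
  by have [x /(_ i)[Mx]] := filter_ex Md; rewrite tnth_mktuple -Mx.
have {}Um : \forall x \near U, (m < l)%N -> (k <= M x m.+1 - M x m)%N.
  have [/Um/(_ k)|lem] := ltnP m l; first by apply: filterS => x.
  by apply: filterS filterT.
apply: filterS3 UJ Md Um => x Jx Mx Mm; split=> // i.
by rewrite tnth_mktuple; case: (Mx i).
Qed.

(** Mirror image of [ultra_lower_gaps]: gaps are counted down from the largest value, and offsets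
    are measured to [M m], so the [i]-th one sums the gaps from [i] to [m - 1]. *)
Lemma ultra_upper_gaps :
  exists (l m : nat) (J : l.+1.-tuple {fset 'X_{1..n}}) (d : m.-tuple nat),
    [/\ (m <= l)%N, forall i : 'I_m, (0 < tnth d i)%N &
    forall k, \forall x \near U,
      let M := nth 0%N (rev (plm_values (t x) P)) in
      [/\ rev J = plm_partition (t x) P,
          forall i : 'I_m, (M i - M m = tnth d i)%N &
          (m < l)%N -> (k <= M m - M m.+1)%N]].
Proof.
have [l [J0 UJ]] := ultra_partition; pose J := rev_tuple J0.
rewrite -[tval J0]revK in UJ.
pose M x := nth 0%N (rev (plm_values (t x) P)).
have [m [e [le_ml Ue Um]]] := ultra_gaps (fun i x => M x i - M x i.+1)%N l.
have Md : \forall x \near U, forall i : 'I_m,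
    (M x i - M x m = \sum_(i <= j < m) e j)%N /\ (0 < M x i - M x m)%N.
  have {}Ue : \forall x \near U, forall i : 'I_m, (M x i - M x i.+1 = e i)%N.
    by apply: filter_forall => i; apply: Ue.
  apply: filterS2 UJ Ue => x Jx ex i.
  have szM : size (rev (plm_values (t x) P)) = l.+1.
    by rewrite size_rev -size_plm_partition -Jx size_tuple.
  have ltM j k : (j < k)%N -> (k <= m)%N -> (M x k < M x j)%N.
    move=> lt_jk le_km.
    apply: (sorted_ltn_nth (leT := fun j k => k < j)%N) _ _ _ _ _ _ _ => //.
    - by move=> a b c; lia.
    - by rewrite rev_sorted plm_values_sorted.
    - by rewrite inE szM; lia.
    - by rewrite inE szM; lia.
  have lt_im := ltn_ord i; rewrite subn_gt0 ltM //; split=> //.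
  have <- : (\sum_(i <= j < m) (M x j - M x j.+1) = M x i - M x m)%N.
    rewrite (telescope_big (fun j k => M x j - M x k)%N) ?lt_im // => j.
    move=> /andP[ij jm]; have := ltM _ _ ij (ltnW jm).
    by have := ltM _ _ (ltnSn j) jm; rewrite /=; lia.
  by apply: eq_big_nat => j /andP[_ hj]; rewrite (ex (Ordinal hj)).
exists l, m, J, [tuple \sum_(i <= j < m) e j | i < m]%N; split=> // [i|k].
  by have [x /(_ i)[Mx]] := filter_ex Md; rewrite tnth_mktuple -Mx.
have {}Um : \forall x \near U, (m < l)%N -> (k <= M x m - M x m.+1)%N.
  have [/Um/(_ k)|lem] := ltnP m l; first by apply: filterS => x.
  by apply: filterS filterT.
apply: filterS3 UJ Md Um => x Jx Mx Mm; split=> // i.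
by rewrite tnth_mktuple; case: (Mx i).
Qed.

End UltrafilterOfMaps.

(** * Translates of polynomials *)

Lemma mpoly_ring_ind (n : nat) (R : comNzRingType) (Q : {mpoly R[n]} -> Prop) :
  (forall c, Q c%:MP) -> (forall i, Q 'X_i) ->
  (forall p q, Q p -> Q q -> Q (p + q)) ->
  (forall p q, Q p -> Q q -> Q (p * q)) -> forall p, Q p.
Proof.
move=> QC QX QD QM p; rewrite (mpolyE p).
elim/big_ind: _ => [|p1 p2|alpha _]; [by rewrite -mpolyC0 | exact: QD |].
rewrite -mul_mpolyC; apply: (QM) => //; rewrite mpolyXE_id.
elim/big_ind: _ => [|p1 p2|i _]; [by rewrite -mpolyC1 | exact: QM |].
elim: (alpha i) => [|k IHk]; first by rewrite expr0 -mpolyC1.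
by rewrite exprS; apply: QM.
Qed.

Lemma mcoeff_mpoly0 (n : nat) (R : comNzRingType) (p : {mpoly R[n]}) :
  p@_0 = p.@[fun=> 0].
Proof.
rewrite mevalE [p in LHS]mpolyE raddf_sum; apply: eq_bigr => alpha _ /=.
rewrite mcoeffZ mcoeffX; congr (_ * _).
by rewrite -[RHS]/(mmap1 (fun=> 0) alpha) mmap1_cst expr0n mdeg_eq0.
Qed.

Lemma horner_mpoly_diag (n : nat) (P : {mpoly int[n]}) (x : int) :
  (mpoly_diag P).[x] = P.@[fun=> x].
Proof.
rewrite horner_sum; apply: eq_bigr => alpha _.
by rewrite hornerCM !mmap1_cst hornerXn.
Qed.

Section Translation.
Variables (n : nat).
Implicit Types (P Q : {mpoly int[n]}) (a : int).

Lemma mpoly_shiftC a c : mpoly_shift a (c%:MP : {mpoly int[n]}) = c%:MP.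
Proof. exact: comp_mpolyC. Qed.

Lemma mpoly_shiftX a (i : 'I_n) : mpoly_shift a 'X_i = 'X_i + a%:MP.
Proof. by rewrite /mpoly_shift comp_mpolyXU -tnth_nth tnth_mktuple. Qed.

Lemma mpoly_shiftD a P Q :
  mpoly_shift a (P + Q) = mpoly_shift a P + mpoly_shift a Q.
Proof. exact: comp_mpolyD. Qed.

Lemma mpoly_shiftM a P Q :
  mpoly_shift a (P * Q) = mpoly_shift a P * mpoly_shift a Q.
Proof. exact: rmorphM. Qed.

Lemma mpoly_shiftK a : cancel (@mpoly_shift n a) (mpoly_shift (- a)).
Proof.
apply: mpoly_ring_ind => [c|i|P Q|P Q]; first by rewrite !mpoly_shiftC.
- by rewrite mpoly_shiftX mpoly_shiftD mpoly_shiftX mpoly_shiftC mpolyCN subrK.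
- by rewrite !mpoly_shiftD => -> ->.
by rewrite !mpoly_shiftM => -> ->.
Qed.

Lemma mpoly_shift_neq0 a P : P != 0 -> mpoly_shift a P != 0.
Proof.
apply: contraNneq => Pa0; rewrite -(mpoly_shiftK a P) Pa0 -mpolyC0.
by rewrite mpoly_shiftC.
Qed.

Lemma meval_shift a P (v : 'I_n -> int) :
  (mpoly_shift a P).@[v] = P.@[fun i => v i + a].
Proof.
rewrite comp_mpoly_meval; apply: meval_eq => i.
by rewrite tnth_mktuple mevalD mevalXU mevalC.
Qed.

Lemma mderiv_shift a (i : 'I_n) P :
  (mpoly_shift a P)^`M(i) = mpoly_shift a P^`M(i).
Proof.
elim/mpoly_ring_ind: P => [c|j|P Q|P Q].
- by rewrite mpoly_shiftC !mderivC -mpolyC0 mpoly_shiftC.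
- rewrite mpoly_shiftX mderivD mderivC addr0 mderivX.
  rewrite -mul_mpolyC mpoly_shiftM mpoly_shiftC mnm1E.
  case: eqVneq => [->|_]; rewrite ?mpolyC0 ?mul0r //.
  by rewrite -[X in (X - _)%MM]add0m addmK mpolyX0 -mpolyC1 mpoly_shiftC.
- by rewrite !(mpoly_shiftD, mderivD) => -> ->.
by rewrite !(mpoly_shiftD, mpoly_shiftM, mderivM) => -> ->.
Qed.

Lemma mderivm_shift a (alpha : 'X_{1..n}) P :
  (mpoly_shift a P)^`M[alpha] = mpoly_shift a P^`M[alpha].
Proof.
by rewrite !mderivm_foldr; elim: (flatten _) => //= i s ->; apply: mderiv_shift.
Qed.

(** Derivatives commute with translation, which moves the point [a] to 0; there the alpha-th
    derivative is alpha! times the coefficient of x^alpha, so the division is exact. *)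
Lemma taylor_coefE P a (alpha : 'X_{1..n}) :
  taylor_coef P a alpha = (mpoly_shift a P)@_alpha.
Proof.
rewrite /taylor_coef.
have -> : P^`M[alpha].@[fun=> a] = (mpoly_shift a P^`M[alpha]).@[fun=> 0].
  by rewrite meval_shift; apply: meval_eq => i; rewrite add0r.
rewrite -mcoeff_mpoly0 -mderivm_shift mcoeff_mderivm addm0 -mulr_natr natz.
under eq_bigr do rewrite ffactnn.
by rewrite mulzK // -lt0n prodn_gt0 // => i; apply: fact_gt0.
Qed.

End Translation.

(** * p-adic limits *)

Lemma Zp_int_eq0 (m : nat) (z : int) : (1 < m)%N ->
  ((z%:~R : 'Z_m) == 0) = (m %| `|z|)%N.
Proof.
move=> m_gt1; have nat_case (k : nat) : ((k%:R : 'Z_m) == 0) = (m %| k)%N.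
  by rewrite -val_eqE /= Zp_nat /= Zp_cast.
by case: z => k; rewrite ?NegzE ?mulrNz ?oppr_eq0 -pmulrn nat_case.
Qed.

Lemma Zp_int_unit (m : nat) (z : int) : (1 < m)%N ->
  ((z%:~R : 'Z_m) \is a GRing.unit) = coprime m `|z|.
Proof.
move=> m_gt1; rewrite -(unitZpE _ m_gt1).
by case: z => k; rewrite ?NegzE ?mulrNz ?unitrN -pmulrn.
Qed.

Section PadicProjection.
Variables (p k : nat).

(** A name for the projection, to carry the ring morphism structure by which equations over
    [padic p] are checked level by level. *)
Definition padic_proj (u : padic p) : 'Z_(p ^ k.+1) := u k.

Fact padic_proj_is_zmod_morphism : zmod_morphism padic_proj.
Proof. by []. Qed.
HB.instance Definition _ :=
  GRing.isZmodMorphism.Build (padic p) 'Z_(p ^ k.+1) padic_proj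
    padic_proj_is_zmod_morphism.

Fact padic_proj_is_monoid_morphism : monoid_morphism padic_proj.
Proof. by []. Qed.
HB.instance Definition _ :=
  GRing.isMonoidMorphism.Build (padic p) 'Z_(p ^ k.+1) padic_proj
    padic_proj_is_monoid_morphism.

Lemma padic_proj_horner (f : {poly int}) (w : padic p) :
  (map_poly intr f).[w] k = (map_poly intr f).[w k].
Proof.
rewrite -[LHS]/(padic_proj _) -horner_map -map_poly_comp.
by congr _.[_]; apply: eq_map_poly => z /=; rewrite rmorph_int.
Qed.

End PadicProjection.

(** The levelwise inverses are coherent because reduction is multiplicative and inverses are
    unique. *)
Lemma padic_unitE (p : nat) (w : padic p) :
  (forall k, w k \is a GRing.unit) -> w \is a GRing.unit.
Proof.
move=> wU; have vP : padic_coherent (fun k => (w k)^-1).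
  move=> k; apply: (mulIr (wU k)); rewrite (mulVr (wU k)).
  rewrite -(padic_valP w k) -[LHS]padic_redM (mulVr (wU k.+1)).
  exact: (padic_red_nat p k 1).
by apply/unitrPr; exists (Padic vP); apply: padicP => k; apply: (divrr (wU k)).
Qed.

Lemma pfactor_ndvd_mul (p j k u v : nat) : prime p ->
  ~~ (p ^ j %| u)%N -> ~~ (p ^ k %| v)%N -> ~~ (p ^ (j + k) %| u * v)%N.
Proof.
move=> p_pr; have [->|u_gt0] := posnP u; first by rewrite dvdn0.
have [->|v_gt0] := posnP v; first by rewrite dvdn0.
by rewrite !pfactor_dvdn ?muln_gt0 ?u_gt0 // lognM //; lia.
Qed.

(** [M 0] is the least value, so the subtractions are exact. The power of [b] is factored out in
    order to be cancelled over [int], before reduction modulo a power of p. *)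
Lemma mmap_plm_scaled (n : nat) (P : {mpoly int[n]}) (t : {ffun 'I_n -> nat})
    (K : comNzRingType) (b : K) (u : 'I_n -> K) :
  let M := nth 0%N (plm_values t P) in
  mmap intr (fun i => b ^+ t i * u i) P =
  b ^+ M 0 * \sum_(i < size (plm_values t P)) b ^+ (M i - M 0) *
    \sum_(alpha <- nth fset0 (plm_partition t P) i)
       (P@_alpha)%:~R * mmap1 u alpha.
Proof.
move=> M; rewrite mmap_plm mulr_sumr; apply: eq_bigr => i _.
rewrite mulrA -exprD subnKC //.
have := plm_values_sorted P t; rewrite ltn_sorted_uniq_leq => /andP[_ Ms].
by apply: (sorted_leq_nth leq_trans leqnn _ Ms);
  rewrite ?inE ?ltn_ord // (leq_ltn_trans _ (ltn_ord i)).
Qed.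

(** Up to [m] the exponents are the prescribed offsets; beyond [m] they are at least [k], and those
    terms vanish with [b ^+ k]. *)
Lemma lower_rado_truncation (K : comNzRingType) (M : nat -> nat)
    (l m k : nat) (d : m.-tuple nat) (b : K) (F : nat -> K) :
  {in [pred i | i <= l]%N &, {homo M : i j / (i <= j)%N}} ->
  (m <= l)%N -> (forall i : 'I_m, (M i.+1 - M 0 = tnth d i)%N) ->
  ((m < l)%N -> (k <= M m.+1 - M m)%N) -> b ^+ k = 0 ->
  \sum_(i < m.+1) b ^+ nth 0%N (0%N :: d) i * F i =
  \sum_(i < l.+1) b ^+ (M i - M 0) * F i.
Proof.
move=> Mle le_ml Md Mm bk0.
rewrite (big_ord_widen l.+1 (fun i => b ^+ nth 0%N (0%N :: d) i * F i)) //.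
rewrite big_mkcond /=; apply: eq_bigr => -[i /= lt_il] _.
have [lt_im|le_mi] := ltnP i m.+1.
  case: i lt_im {lt_il} => [|i] lt_im; first by rewrite subnn.
  by rewrite (Md (Ordinal (lt_im : i < m)%N)) /= (tnth_nth 0%N).
have lt_ml : (m < l)%N by apply: leq_trans le_mi _.
have : (k <= M i - M 0)%N.
  have := Mm lt_ml; have := Mle m.+1 i lt_ml lt_il le_mi.
  by have := Mle 0%N m (leq0n _) le_ml (leq0n _); lia.
by move=> le_k; rewrite -(subnKC le_k) exprD bk0 !mul0r.
Qed.

(** * The minimal Rado condition at a prime p *)

Section MinimalRado.
Variables (n : nat) (P : {mpoly int[n]}) (U : set_system ('I_n -> nat)).
Variables (p : nat) (i0 : 'I_n).
Hypothesis p_prime : prime p.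
Context {UU : UltraFilter U}.
Hypothesis U_zero : \forall x \near U, P.@[fun i => (x i)%:Z] = 0.
Hypothesis U_large : forall N, \forall x \near U, forall i, (N <= x i)%N.
Hypothesis U_mono : forall (I : finType) (f : nat -> I),
  \forall x \near U, forall i j, f (x i) = f (x j).

Let pX_gt1 k : (1 < p ^ k.+1)%N.
Proof. by rewrite -[1%N](expn0 p) ltn_exp2l ?prime_gt1. Qed.

(** Either some factor has unbounded valuation along U, so that x_(i0) tends to its root, or all
    valuations are bounded and so is their sum, [c] being nonzero. *)
Lemma ultra_padic_root_or_ndvd (c : int) (s : seq int) : c != 0 ->
  (exists2 a, a \in s &
     forall k, \forall x \near U, (p ^ k %| `|(x i0)%:Z - a|)%N) \/
  (exists k, \forall x \near U,
     ~~ (p ^ k %| `|(c *: \prod_(a <- s) ('X - a%:P)).[(x i0)%:Z]|)%N).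
Proof.
move=> c_neq0; elim: s => [|a s [[b sb Ub]|[k Uk]]].
- right; exists (logn p `|c|).+1; apply: filterS filterT => x _.
  rewrite big_nil hornerZ hornerC mulr1 pfactor_dvdn ?absz_gt0 //.
  by rewrite ltnn.
- by left; exists b => //; rewrite inE sb orbT.
have [Ua|nUa] := pselect (forall k,
  \forall x \near U, (p ^ k %| `|(x i0)%:Z - a|)%N).
  by left; exists a => //; rewrite mem_head.
have [j Uj] : exists j, \forall x \near U, ~~ (p ^ j %| `|(x i0)%:Z - a|)%N.
  apply: contrapT => nUj; apply: nUa => j.
  have [//|Uj] := ultra_dec (U := U) [set x | (p ^ j %| `|(x i0)%:Z - a|)%N].
  by case: nUj; exists j; apply: filterS Uj => x /negP.
right; exists (j + k)%N; apply: filterS2 Uj Uk => x xj xk.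
rewrite big_cons hornerZ hornerM mulrCA -hornerZ hornerXsubC abszM.
exact: pfactor_ndvd_mul.
Qed.

(** Modulo any power of p the x_i agree along U, so P(x) = 0 makes the diagonal at x_(i0) divisible
    by that power. This excludes bounded valuation. *)
Lemma ultra_padic_root :
  mpoly_diag P != 0 -> splits_over_int (mpoly_diag P) ->
  exists2 a, root (mpoly_diag P) a &
    forall k, \forall x \near U, forall i, (p ^ k %| `|(x i)%:Z - a|)%N.
Proof.
move=> D_neq0 [c [s ED]].
have c_neq0 : c != 0 by apply: contraNneq D_neq0 => c0; rewrite ED c0 scale0r.
have [[a sa Ua]|[k Uk]] := ultra_padic_root_or_ndvd s c_neq0.
  exists a => [|k]; first by rewrite ED rootZ // root_prod_XsubC.
  have Uf := U_mono (fun x : nat => x%:R : 'Z_(p ^ k.+1)).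
  apply: filterS2 (Ua k.+1) Uf => x xa xf i.
  apply: dvdn_trans (dvdn_exp2l p (leqnSn k)) _.
  move: xa; rewrite -!Zp_int_eq0 // !rmorphB /= -!pmulrn => /eqP <-.
  by rewrite (xf i i0).
have Uf := U_mono (fun x : nat => x%:R : 'Z_(p ^ k.+1)).
have [x [[x0 xf] /negP[]]] := filter_ex (filterI (filterI U_zero Uf) Uk).
apply: dvdn_trans (dvdn_exp2l p (leqnSn k)) _.
rewrite -ED -Zp_int_eq0 // horner_mpoly_diag intr_meval.
have <- : mmap intr (fun i => (x i)%:Z%:~R) P = 0 :> 'Z_(p ^ k.+1).
  by rewrite -intr_meval x0.
apply/eqP/eq_bigr => alpha _; congr (_ * _); apply: mmap1_eq => i.
exact: xf.
Qed.

Section AtRoot.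
Variable a : int.
Hypothesis U_root : forall k, \forall x \near U,
  forall i, (p ^ k %| `|(x i)%:Z - a|)%N.

(* At x = a this is 0, and [padic_cofactor] is then 0. *)
Definition padic_val_at (x : nat) : nat := logn p `|x%:Z - a|.
Definition padic_cofactor (x : nat) : int :=
  ((x%:Z - a) %/ (p ^ padic_val_at x)%N%:Z)%Z.

Let neq_root : \forall x \near U, forall i, (x i)%:Z - a != 0.
Proof.
apply: filterS (U_large `|a|.+1) => x xa i; rewrite subr_eq0.
by apply/eqP => Ea; have := xa i; rewrite -Ea ltnn.
Qed.

Lemma padic_cofactorE (x : nat) :
  x%:Z - a = p%:Z ^+ padic_val_at x * padic_cofactor x.
Proof.
rewrite mulrC -[p%:Z]natz -natrX natz divzK //.
by rewrite dvdzE /= pfactor_dvdnn.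
Qed.

Lemma padic_cofactor_coprime (x : nat) :
  x%:Z - a != 0 -> coprime p `|padic_cofactor x|.
Proof.
rewrite -absz_gt0 => xa; rewrite prime_coprime //; apply/negP => dvd_p.
have : (p ^ (padic_val_at x).+1 %| `|x%:Z - a|)%N.
  by rewrite padic_cofactorE abszM abszX expnSr dvdn_mul.
by rewrite pfactor_dvdn // ltnn.
Qed.

Let t (x : 'I_n -> nat) := [ffun i => padic_val_at (x i)].

(** Convergence to [a] makes the valuations unbounded once x_i = a, where [logn] returns 0, is
    excluded. *)
Let t_large N : \forall x \near U, forall i, (N <= t x i)%N.
Proof.
apply: filterS2 neq_root (U_root N) => x xa xN i.
by rewrite ffunE -pfactor_dvdn // absz_gt0.
Qed.

(** Each integer is coloured by the colour of its exponent. *)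
Let t_mono (I : finType) (f : nat -> I) :
  \forall x \near U, forall i j, f (t x i) = f (t x j).
Proof.
apply: filterS (U_mono (f \o padic_val_at)) => x xf i j.
by rewrite !ffunE; apply: xf.
Qed.

(** At each level the cofactor has finitely many residues, hence a single one along U; consecutive
    levels are compared at a common point. A residue is a finite colouring, so all coordinates share
    the limit. *)
Lemma ultra_padic_limit : exists2 w : padic p, w \is a GRing.unit &
  forall k, \forall x \near U, forall i, (padic_cofactor (x i))%:~R = w k.
Proof.
have Uw k := ultra_fin (UU := UU)
  (fun x => (padic_cofactor (x i0))%:~R : 'Z_(p ^ k.+1)).
pose w k := projT1 (cid (Uw k)).
have Ucof k : \forall x \near U, (padic_cofactor (x i0))%:~R = w k.
  exact: (projT2 (cid (Uw k))).
have wP : padic_coherent w.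
  move=> k; have [x [<- <-]] := filter_ex (filterI (Ucof k) (Ucof k.+1)).
  rewrite -/(padic_red _); case: (padic_cofactor (x i0)) => j.
    by rewrite -!pmulrn padic_red_nat.
  by rewrite NegzE !mulrNz padic_redN -!pmulrn padic_red_nat.
exists (Padic wP) => [|k].
  apply: padic_unitE => k /=.
  have [x [<- /(_ i0)/padic_cofactor_coprime]] :=
    filter_ex (filterI (Ucof k) neq_root).
  by rewrite Zp_int_unit // coprime_pexpl.
have Uf := U_mono (fun x => (padic_cofactor x)%:~R : 'Z_(p ^ k.+1)).
by apply: filterS2 (Ucof k) Uf => x /= <- xf i; apply: xf.
Qed.

Lemma ultra_lower_rado : P != 0 ->
  exists (l m : nat) (J : l.+1.-tuple {fset 'X_{1..n}}) (d : m.-tuple nat),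
    lower_rado_functional (mpoly_shift a P) J d /\
    exists w : padic p, w \is a GRing.unit /\
      root (map_poly intr (rado_poly (taylor_coef P a) p m J (0%N :: d))) w.
Proof.
move=> P_neq0; have Q_neq0 := mpoly_shift_neq0 a P_neq0.
have n_gt0 : (0 < n)%N by apply: leq_ltn_trans (ltn_ord i0).
have [l [m [J [d [le_ml d_gt0 UJ]]]]] := ultra_lower_gaps t Q_neq0.
exists l, m, J, d; split.
  split=> // r c k k_gt0; apply: (ultra_infinite n_gt0 t_large).
  by apply: filterS2 (ultra_monochromatic t_large t_mono c) (UJ k) => x ? [].
have [w w_unit Uw] := ultra_padic_limit; exists w; split=> //.
apply/eqP/padicP => k; rewrite padic_proj_horner horner_rado_poly.
set K : comNzRingType := 'Z_(p ^ k.+1).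
have pK0 : p%:R ^+ k.+1 = 0 :> K.
  by apply/eqP; rewrite -natrX pmulrn Zp_int_eq0.
(* One solution suffices for level [k]: a gap of at least k + 1 after [m] kills the later terms
   modulo p^(k+1). *)
have [x [[xP xw] [xJ xd xm]]] :=
  filter_ex (filterI (filterI U_zero (Uw k)) (UJ k.+1)).
pose u i := padic_cofactor (x i).
pose M := nth 0%N (plm_values (t x) (mpoly_shift a P)).
have : mmap intr (fun i => p%:Z ^+ t x i * u i) (mpoly_shift a P) = 0.
  rewrite -[RHS]xP -[RHS](meval_eq P (fun i => subrK a (x i)%:Z)).
  rewrite -(meval_shift a P (fun i => (x i)%:Z - a)) -[RHS]intz intr_meval.
  apply: eq_bigr => alpha _; congr (_ * _); apply: mmap1_eq => i.
  by rewrite intz ffunE -padic_cofactorE.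
have pZ_neq0 : p%:Z != 0 by rewrite eqz_nat -lt0n prime_gt0.
rewrite mmap_plm_scaled => /eqP.
rewrite mulf_eq0 expf_eq0 (negPf pZ_neq0) andbF.
move=> /eqP/(congr1 (intr : int -> K)); rewrite rmorph_sum rmorph0 /=.
have szM : size (plm_values (t x) (mpoly_shift a P)) = l.+1.
  by rewrite -size_plm_partition -xJ size_tuple.
rewrite szM -xJ => sum0; apply: (etrans _ sum0) => {sum0}.
have Ms : {in [pred i | i <= l]%N &, {homo M : i j / (i <= j)%N}}.
  have := plm_values_sorted (mpoly_shift a P) (t x).
  rewrite ltn_sorted_uniq_leq => /andP[_ Ms] i j hi hj.
  by apply: (sorted_leq_nth leq_trans leqnn _ Ms); rewrite inE szM.
rewrite (lower_rado_truncation (fun i => \sum_(alpha <- nth fset0 J i)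
  (taylor_coef P a alpha)%:~R * mmap1 (fun=> w k) alpha) Ms le_ml xd xm pK0).
apply: eq_bigr => i _.
rewrite rmorphM rmorphXn /= rmorph_sum /=; congr (_ * _).
apply: eq_bigr => alpha _; rewrite taylor_coefE intz rmorphM /=; congr (_ * _).
by rewrite rmorph_prod; apply: eq_bigr => j _; rewrite /= rmorphXn /= xw.
Qed.

End AtRoot.
End MinimalRado.

(** * Real limits along an ultrafilter *)

Section RealLimits.
Context {R : realType} {T : Type} {U : set_system T} {UU : UltraFilter U}.

Definition ulim (f : T -> R) (v : R) : Prop :=
  forall e, 0 < e -> \forall x \near U, `|f x - v| < e.

Lemma ulim_near_eq (f g : T -> R) (v : R) :
  (\forall x \near U, f x = g x) -> ulim f v -> ulim g v.
Proof. by move=> fg fv e /fv; apply: filterS2 fg => x ->. Qed.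

Lemma ulim_cst (v : R) : ulim (fun=> v) v.
Proof. by move=> e e0; apply: filterS filterT => x _; rewrite subrr normr0. Qed.

Lemma ulim_unique (f : T -> R) (v w : R) : ulim f v -> ulim f w -> v = w.
Proof.
move=> fv fw; apply/eqP/contraT => vw.
have e0 : 0 < `|v - w| / 2 by rewrite divr_gt0 // normr_gt0 subr_eq0.
have [x [xv xw]] := filter_ex (filterI (fv _ e0) (fw _ e0)).
have := ler_distD (f x) v w; rewrite (distrC v (f x)); lra.
Qed.

Lemma ulimD (f g : T -> R) (v w : R) :
  ulim f v -> ulim g w -> ulim (fun x => f x + g x) (v + w).
Proof.
move=> fv gw e e0; have e2 : 0 < e / 2 by lra.
apply: filterS2 (fv _ e2) (gw _ e2) => x fx gx.
rewrite opprD addrACA (le_lt_trans (ler_normD _ _)) //; lra.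
Qed.

Lemma ulimM (f g : T -> R) (v w : R) :
  ulim f v -> ulim g w -> ulim (fun x => f x * g x) (v * w).
Proof.
move=> fv gw e e0; pose c := 1 + `|v| + `|w|.
have c1 : 1 <= c by rewrite /c -addrA lerDl addr_ge0.
(* [d <= 1] gives |A B| <= |A|, so the three error terms below add up to less than d (1 + |v| + |w|)
   = d c <= e. *)
pose d := Num.min 1 (e / c).
have d0 : 0 < d by rewrite lt_min ltr01 divr_gt0 // (lt_le_trans ltr01).
apply: filterS2 (fv _ d0) (gw _ d0) => x fx gx.
have -> : f x * g x - v * w =
    (f x - v) * (g x - w) + v * (g x - w) + w * (f x - v) by ring.
set A := f x - v in fx *; set B := g x - w in gx *.
have dc : d * c <= e.
  by rewrite -ler_pdivlMr ?(lt_le_trans ltr01) // ge_min lexx orbT.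
have AB : `|A * B| <= `|A|.
  rewrite normrM ler_piMr // ltW // (lt_le_trans gx) //.
  by rewrite ge_min lexx.
have vB : `|v * B| <= `|v| * d by rewrite normrM ler_wpM2l // ltW.
have wA : `|w * A| <= `|w| * d by rewrite normrM ler_wpM2l // ltW.
have := ler_normD (A * B + v * B) (w * A); have := ler_normD (A * B) (v * B).
rewrite /c !mulrDr in dc; lra.
Qed.

Lemma ulim_sum (I : Type) (r : seq I) (f : I -> T -> R) (v : I -> R) :
  (forall i, ulim (f i) (v i)) ->
  ulim (fun x => \sum_(i <- r) f i x) (\sum_(i <- r) v i).
Proof.
move=> fv; elim: r => [|i r IHr].
  by under eq_fun do rewrite big_nil; rewrite big_nil; apply: ulim_cst.
by under eq_fun do rewrite big_cons; rewrite big_cons; apply: ulimD.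
Qed.

Lemma ulim_prod (I : Type) (r : seq I) (f : I -> T -> R) (v : I -> R) :
  (forall i, ulim (f i) (v i)) ->
  ulim (fun x => \prod_(i <- r) f i x) (\prod_(i <- r) v i).
Proof.
move=> fv; elim: r => [|i r IHr].
  by under eq_fun do rewrite big_nil; rewrite big_nil; apply: ulim_cst.
by under eq_fun do rewrite big_cons; rewrite big_cons; apply: ulimM.
Qed.

Lemma ulimX (f : T -> R) (v : R) (k : nat) :
  ulim f v -> ulim (fun x => f x ^+ k) (v ^+ k).
Proof.
move=> fv; elim: k => [|k IHk].
  by under eq_fun do rewrite expr0; rewrite expr0; apply: ulim_cst.
by under eq_fun do rewrite exprS; rewrite exprS; apply: ulimM.
Qed.

(** The limit is the supremum of the lower bounds of [f] that hold along U. *)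
Lemma ulim_exists (f : T -> R) (a b : R) :
  (\forall x \near U, a <= f x <= b) ->
  exists2 w, a <= w <= b & ulim f w.
Proof.
move=> Uf; pose E := [set r | \forall x \near U, r <= f x].
have Ea : E a by apply: filterS Uf => x /andP[].
have Eb : ubound E b.
  move=> r Er; have [x [rx /andP[_ xb]]] := filter_ex (filterI Er Uf).
  exact: le_trans xb.
have E_ub : has_ubound E by exists b.
have E_sup : has_sup E by split=> //; exists a.
exists (sup E); first by rewrite ub_le_sup // ge_sup //; exists a.
move=> e e0; have [r Er lt_r] := sup_adherent e0 E_sup.
have [Ue|Ue] := ultra_dec [set x | sup E + e <= f x].
  suff : sup E + e <= sup E by lra.
  exact: ub_le_sup.
apply: filterS2 Er Ue => x rx /negP; rewrite -ltNge => xe.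
by rewrite ltr_norml; lra.
Qed.

Lemma ulim_expr_inv (b : R) (g : T -> nat) : 2 <= b ->
  (forall k, \forall x \near U, (k <= g x)%N) ->
  ulim (fun x => b ^- g x) 0.
Proof.
move=> b2 Ug e e0; apply: filterS (Ug (Num.bound e^-1)) => x le_g.
have b0 : 0 < b by lra.
rewrite subr0 gtr0_norm ?invr_gt0 ?exprn_gt0 // invf_plt ?posrE ?exprn_gt0 //.
rewrite (lt_le_trans (archi_boundP (ltW _))) ?invr_gt0 //.
apply: (@le_trans _ _ ((2 ^ g x)%N%:R)).
  by rewrite ler_nat (leq_trans le_g) // ltnW // ltn_expl.
by rewrite natrX lerXn2r ?nnegrE ?(ltW b0).
Qed.

End RealLimits.

Lemma mmap_plm_rev (n : nat) (P : {mpoly int[n]}) (t : {ffun 'I_n -> nat})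
    (K : comNzRingType) (b : K) (u : 'I_n -> K) :
  mmap intr (fun i => b ^+ t i * u i) P =
  \sum_(i < size (plm_values t P)) b ^+ nth 0%N (rev (plm_values t P)) i *
    \sum_(alpha <- nth fset0 (rev (plm_partition t P)) i)
       (P@_alpha)%:~R * mmap1 u alpha.
Proof.
rewrite mmap_plm (reindex_inj rev_ord_inj); apply: eq_bigr => i _ /=.
by rewrite !nth_rev ?size_plm_partition.
Qed.

(** * The maximal Rado condition in base q *)

Section MaximalRado.
Variables (R : realType) (n : nat) (P : {mpoly int[n]}).
Variables (U : set_system ('I_n -> nat)) (q : nat) (i0 : 'I_n).
Hypothesis P_neq0 : P != 0.
Hypothesis q_gt1 : (1 < q)%N.
Context {UU : UltraFilter U}.
Hypothesis U_zero : \forall x \near U, P.@[fun i => (x i)%:Z] = 0.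
Hypothesis U_large : forall N, \forall x \near U, forall i, (N <= x i)%N.
Hypothesis U_mono : forall (I : finType) (f : nat -> I),
  \forall x \near U, forall i j, f (x i) = f (x j).

Let t (x : 'I_n -> nat) := [ffun i => trunc_log q (x i)].

Let t_large N : \forall x \near U, forall i, (N <= t x i)%N.
Proof.
apply: filterS (U_large (q ^ N)) => x xN i.
by rewrite ffunE trunc_log_max.
Qed.

Let t_mono (I : finType) (f : nat -> I) :
  \forall x \near U, forall i j, f (t x i) = f (t x j).
Proof.
apply: filterS (U_mono (f \o trunc_log q)) => x xf i j.
by rewrite !ffunE; apply: xf.
Qed.

Definition mantissa (x : nat) : R := x%:R / q%:R ^+ trunc_log q x.

Let qX_gt0 k : 0 < (q%:R : R) ^+ k.
Proof. by rewrite exprn_gt0 // ltr0n ltnW. Qed.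

Lemma mantissaE (x : nat) : x%:R = q%:R ^+ trunc_log q x * mantissa x.
Proof. by rewrite mulrC divfK // gt_eqF. Qed.

(** The mantissa is even below q, but only the closed interval survives passage to the limit. *)
Lemma mantissa_bound (x : nat) : (0 < x)%N -> 1 <= mantissa x <= q%:R.
Proof.
move=> x_gt0; have [//|/(trunc_log_bounds q_gt1)/andP[qx xq]] := posnP x.
  by move=> x0; rewrite x0 in x_gt0.
rewrite /mantissa ler_pdivlMr // ler_pdivrMr // mul1r -exprS -!natrX !ler_nat.
by rewrite qx ltnW.
Qed.

(** Being within [e] of [w] is a colouring with two colours, so a limit for one coordinate is a
    limit for all. *)
Lemma ultra_mantissa_limit : exists2 w : R, 1 <= w <= q%:R &
  forall i, ulim (U := U) (fun x => mantissa (x i)) w.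
Proof.
have [|w w_bound w_lim] := ulim_exists (U := U)
    (f := fun x => mantissa (x i0)) (a := 1) (b := q%:R).
  by apply: filterS (U_large 1) => x x1; apply: mantissa_bound.
exists w => // i e /w_lim we.
apply: filterS2 we (U_mono (fun x => `|mantissa x - w| < e)) => x xe /(_ i i0).
by rewrite xe.
Qed.

Lemma ultra_upper_rado :
  exists (l m : nat) (J : l.+1.-tuple {fset 'X_{1..n}}) (d : m.-tuple nat),
    upper_rado_functional P J d /\
    exists w : R, 1 <= w <= q%:R /\
      root (map_poly intr
        (rado_poly (fun alpha => P@_alpha) q m J (rcons d 0%N))) w.
Proof.
have n_gt0 : (0 < n)%N by apply: leq_ltn_trans (ltn_ord i0).
have [l [m [J [d [le_ml d_gt0 UJ]]]]] := ultra_upper_gaps t P_neq0.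
exists l, m, J, d; split.
  split=> // r c k k_gt0; apply: (ultra_infinite n_gt0 t_large).
  by apply: filterS2 (ultra_monochromatic t_large t_mono c) (UJ k) => x ? [].
have [w w_bound w_lim] := ultra_mantissa_limit; exists w; split=> //.
apply/eqP; rewrite horner_rado_poly.
pose M x := nth 0%N (rev (plm_values (t x) P)).
pose S (u : 'I_n -> R) (i : nat) :=
  \sum_(alpha <- nth fset0 J i) (P@_alpha)%:~R * mmap1 u alpha.
(* [B x i] is the factor of class [i] after division by q^(M_m); its limit [e i] is q^(d_i) for i <
   m, 1 for i = m and 0 for i > m. *)
pose B x i : R := q%:R ^+ M x i / q%:R ^+ M x m.
pose e i : R := if (i < m.+1)%N then q%:R ^+ nth 0%N (rcons d 0%N) i else 0.
have B_lim (i : 'I_l.+1) : ulim (U := U) (fun x => B x i) (e i).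
  rewrite /e ltnS leq_eqVlt; case: eqVneq => [->|ne_im] /=.
    rewrite nth_rcons size_tuple ltnn eqxx expr0.
    apply: ulim_near_eq (ulim_cst 1); apply: filterS filterT => x _.
    by rewrite /B divff // gt_eqF.
  case: ltnP => [lt_im|le_mi].
    rewrite nth_rcons size_tuple lt_im; apply: ulim_near_eq (ulim_cst _).
    apply: filterS (UJ 1%N) => x [_ /(_ (Ordinal lt_im)) /= Md _].
    have := d_gt0 (Ordinal lt_im); rewrite -Md subn_gt0 => /ltnW.
    rewrite -[nth 0%N d i](tnth_nth 0%N d (Ordinal lt_im)) -Md.
    rewrite -/(M x) => le_M.
    by rewrite /B -[in RHS](subnK le_M) exprD mulfK // gt_eqF.
  have lt_mi : (m < i)%N by rewrite ltn_neqAle eq_sym ne_im.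
  have lt_ml : (m < l)%N by rewrite (leq_trans lt_mi) // -ltnS.
  (* Values after [m] are at most M_(m+1), so one unbounded gap sends all later factors to 0. *)
  have Mi x : rev J = plm_partition (t x) P -> (M x i <= M x m.+1)%N.
    move=> xJ; have szM : size (rev (plm_values (t x) P)) = l.+1.
      by rewrite size_rev -size_plm_partition -xJ size_rev size_tuple.
    have := plm_values_sorted P (t x).
    rewrite ltn_sorted_uniq_leq -rev_sorted => /andP[_ Ms].
    apply: (sorted_leq_nth _ _ 0%N Ms) => //; rewrite ?inE ?szM //.
      by move=> a b c /= ab bc; apply: leq_trans bc ab.
    exact: leqnn.
  apply: (@ulim_near_eq _ _ _ _ (fun x => q%:R ^- (M x m - M x i))).
    apply: filterS (UJ 1%N) => x [xJ _ /(_ lt_ml)].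
    rewrite -/(M x) subn_gt0 => /ltnW le_M.
    have {}le_M := leq_trans (Mi x xJ) le_M.
    rewrite /B -[in RHS](subnK le_M) exprD invfM mulrCA mulfV ?mulr1 //.
    by rewrite gt_eqF.
  apply: ulim_expr_inv => [|k]; first by rewrite ler_nat.
  apply: filterS (UJ k) => x [xJ _ /(_ lt_ml)] /leq_trans; apply.
  exact/leq_sub2l/Mi.
transitivity (\sum_(i < l.+1) e i * S (fun=> w) i).
  rewrite (big_ord_widen l.+1
    (fun i => q%:R ^+ nth 0%N (rcons d 0%N) i * S (fun=> w) i)) //.
  rewrite big_mkcond; apply: eq_bigr => i _; rewrite /e.
  by case: ifP => _; rewrite ?mul0r.
(* The divided sum tends to the value at [w] and is 0 along U, so that value is 0. *)
apply: (@ulim_unique _ _ U _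
  (fun x => \sum_(i < l.+1) B x i * S (fun j => mantissa (x j)) i)).
  apply: ulim_sum => i; apply: ulimM; first exact: B_lim.
  apply: ulim_sum => alpha; apply: ulimM; first exact: ulim_cst.
  by apply: ulim_prod => j; apply: ulimX.
apply: (ulim_near_eq _ (ulim_cst 0)).
apply: filterS2 U_zero (UJ 1%N) => x x0 [xJ _ _].
have := congr1 (intr : int -> R) x0; rewrite intr_meval rmorph0.
have -> : mmap intr (fun i => (x i)%:Z%:~R) P =
    mmap intr (fun i => q%:R ^+ t x i * mantissa (x i)) P :> R.
  apply: eq_bigr => alpha _; congr (_ * _); apply: mmap1_eq => i.
  by rewrite ffunE -mantissaE -pmulrn.
rewrite mmap_plm_rev -size_plm_partition -xJ size_rev size_tuple revK => sum0.
have := congr1 (fun z => z * q%:R ^- M x m) sum0.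
rewrite mul0r mulr_suml => sum1; apply: (etrans (esym sum1)).
apply: eq_bigr => i _.
by rewrite mulrAC.
Qed.

End MaximalRado.

(** Part (1) assumes P nonzero because the zero polynomial has no Rado functional: its support is
    empty, while a functional has l + 1 classes. In part (2) a nonzero diagonal already gives P
    nonzero. *)
Theorem theorem2p19 (R : realType) (n : nat) (P : {mpoly int[n]})
    (P_pr : equation_partition_regular P) :
  (P != 0 -> maximal_rado_condition R P) /\
  (mpoly_diag P != 0 -> splits_over_int (mpoly_diag P) ->
   minimal_rado_condition P).
Proof.
have n_gt0 := equation_pr_gt0 P_pr.
have [U UU [U_zero U_large U_mono]] := equation_pr_ultra P_pr.
pose i0 := Ordinal n_gt0; split=> [P_neq0 q q_gt1|D_neq0 D_splits p p_prime].
  exact: (ultra_upper_rado R i0 P_neq0 q_gt1 U_zero U_large U_mono).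
have P_neq0 : P != 0.
  by apply: contraNneq D_neq0 => ->; rewrite /mpoly_diag mmap0.
have [a a_root Ua] := ultra_padic_root i0 p_prime U_zero U_mono D_neq0 D_splits.
have [l [m [J [d [Jd w_root]]]]] :=
  ultra_lower_rado i0 p_prime U_zero U_large U_mono Ua P_neq0.
by exists a, l, m, J, d; split.
Qed.
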